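(* Let $\mathbb{F}$ be an algebraically closed field of characteristic $0$, let $f(w)=\sum_{i=-1}^{L}f_iw^{i+1}\in\mathbb{F}[w]$, and let $p(x,y)=\sum_{i=0}^{L}f_i\sum_{j=0}^i x^jy^{i-j}=\frac{f(x)-f(y)}{x-y}$. Let $X\in\mathbb{F}^{M\times M}$, $Y\in\mathbb{F}^{N\times N}$ and $P(X,Y)=\sum_{i=0}^{L}f_i\left(\sum_{j=0}^iX^j\otimes Y^{i-j}\right)$. Let $\lambda I_m+N_m$ and $\mu I_n+N_n$ be, respectively, a Jordan block in the Jordan canonical form of $X$ and a Jordan block in the Jordan canonical form of $Y$, with $\lambda\neq\mu$. Let $$\varphi(w)=f(w)-w\,\frac{f(\lambda)-f(\mu)}{\lambda-\mu}\in\mathbb{F}[w],$$ and assume $\varphi(w)\notin\mathbb{F}$ (i.e. $\varphi$ is not constant). Define the positive integers $k,h$ by $$\hat\partial_{w^i}\varphi(\lambda)=0\ \ \forall\,1\le i<k,\quad \hat\partial_{w^k}\varphi(\lambda)\neq0,\qquad \hat\partial_{w^j}\varphi(\mu)=0\ \ \forall\,1\le j<h,\quad \hat\partial_{w^h}\varphi(\mu)\neq0.$$ Define integers $a,q,b,r$ as follows: if $k\ge m$ then $q=m$, $a=0$, and otherwise $m=ak+q$ is the Euclidean division of $m$ by $k$; if $h\ge n$ then $r=n$, $b=0$, and otherwise $n=bh+r$ is the Euclidean division of $n$ by $h$. Define the multisets $\{s_i\}_{i=1}^{\min(k,m)}$ and $\{t_j\}_{j=1}^{\min(h,n)}$ by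 $$s_i=\begin{cases}a+1&\text{if }1\le i\le q;\\ a&\text{if }q+1\le i\le\min(k,m),\end{cases}\qquad t_j=\begin{cases}b+1&\text{if }1\le j\le r;\\ b&\text{if }r+1\le j\le\min(h,n).\end{cases}$$ Then, for each such pair of Jordan blocks of $X$ and $Y$, and for each of the $\min(k,m)\min(h,n)$ pairs $(i,j)$ with $1\le i\le\min(k,m)$ and $1\le j\le\min(h,n)$, the Jordan canonical form of $P(X,Y)$ contains, associated with that pair of Jordan blocks, $\min(s_i,t_j)$ Jordan blocks of eigenvalue $\frac{f(\lambda)-f(\mu)}{\lambda-\mu}$ and sizes $s_i+t_j+1-2\min(s_i,t_j),\ s_i+t_j+3-2\min(s_i,t_j),\ \dots,\ s_i+t_j-1$.
   Context: $\otimes$ is the Kronecker product. $N_m$ is the $m\times m$ matrix with ones on the first superdiagonal and zeros elsewhere; $J_m(\lambda)=\lambda I_m+N_m$. Hasse derivative in one variable: $\hat\partial_{w^i}=\frac{1}{i!}\frac{d^i}{dw^i}$. Lists of sizes increase in steps of $2$. ''Associated with a pair of Jordan blocks'': $P(X,Y)$ is similar to the direct sum of the matrices $P(J_m(\lambda),J_n(\mu))$ over all pairs consisting of a Jordan block $J_m(\lambda)$ of $X$ and a Jordan block $J_n(\mu)$ of $Y$ (counted with multiplicity), and the Jordan blocks associated with a pair are those of the Jordan canonical form of the summand $P(J_m(\lambda),J_n(\mu))$; the blocks listed in the claim are all of the Jordan blocks associated with the pair. *)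

(* Defs.v *)
From HB Require Import structures.
From mathcomp Require Import all_boot all_order all_algebra.
From mathcomp Require Import mxtens.

Set Implicit Arguments.
Unset Strict Implicit.
Unset Printing Implicit Defensive.

Import GRing.Theory.
Local Open Scope ring_scope.

Definition nilp_mx {F : fieldType} (m : nat) : 'M[F]_m :=
  \matrix_(i, j) ((j : nat) == i.+1)%:R.

Definition jordan_block {F : fieldType} (m : nat) (lambda : F) : 'M[F]_m :=
  lambda%:M + nilp_mx m.

(* The cast only reconciles two expressions of the same dimension, such as    *)
(* M and \sum_i p_ i in a block diagonal matrix.                              *)
Definition similar_mx {F : fieldType} (m n : nat)
    (A : 'M[F]_m) (B : 'M[F]_n) : Prop :=
  exists e : n = m, A ~_{in unitmx} (castmx (e, e) B).

(* A pair (lambda, m) stands for the Jordan block J_m(lambda); a list of such *)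
(* pairs, taken up to permutation, is a multiset of Jordan blocks.            *)
Definition blk {F : fieldType} (s : seq (F * nat)) (i : 'I_(size s)) :
    F * nat :=
  tnth (in_tuple s) i.

Definition jordan_mx {F : fieldType} (s : seq (F * nat)) :
    'M[F]_(\sum_(i < size s) (blk i).2) :=
  \mxdiag_(i < size s) jordan_block (blk i).2 (blk i).1.

Definition jordan_form {F : fieldType} (m : nat) (A : 'M[F]_m)
    (s : seq (F * nat)) : Prop :=
  all (fun b => 0 < b.2)%N s /\ similar_mx A (jordan_mx s).

(* The coefficient f_i of w^(i+1) in f is f`_i.+1.                            *)
Definition Pmx {F : fieldType} (L : nat) (f : {poly F}) (M N : nat)
    (X : 'M[F]_M) (Y : 'M[F]_N) : 'M[F]_(M * N) :=
  \sum_(i < L.+1) f`_i.+1 *: \sum_(j < i.+1) (X ^+ j) *t (Y ^+ (i - j)).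

Definition Pblock {F : fieldType} (L : nat) (f : {poly F})
    (b c : F * nat) : 'M[F]_(b.2 * c.2) :=
  Pmx L f (jordan_block b.2 b.1) (jordan_block c.2 c.1).

Definition slope {F : fieldType} (f : {poly F}) (lambda mu : F) : F :=
  (f.[lambda] - f.[mu]) / (lambda - mu).

Definition phi {F : fieldType} (f : {poly F}) (lambda mu : F) : {poly F} :=
  f - (slope f lambda mu) *: 'X.

(* p^`N(i) is the Hasse derivative of order i.                                *)
Definition hasse_order {F : fieldType} (p : {poly F}) (x : F) (k : nat) :
    Prop :=
  [/\ (0 < k)%N,
      forall i : nat, (1 <= i < k)%N -> (p^`N(i)).[x] = 0
    & (p^`N(k)).[x] != 0].

(* The pair (a, q) attached to k and m.                                       *)
Definition split_div (k m : nat) : nat * nat :=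
  if (m <= k)%N then (0%N, m) else ((m %/ k)%N, (m %% k)%N).

(* s_i, for 1 <= i <= minn k m.                                               *)
Definition part_size (k m i : nat) : nat :=
  if (i <= (split_div k m).2)%N then (split_div k m).1.+1
  else (split_div k m).1.

Definition size_list (s t : nat) : seq nat :=
  [seq (s + t + 1 - 2 * minn s t + 2 * l)%N | l <- iota 0 (minn s t)].

Definition pair_blocks {F : fieldType} (nu : F) (k m h n : nat) :
    seq (F * nat) :=
  flatten [seq [seq (nu, d) | d <- size_list (part_size k m i) (part_size h n j)]
          | i <- iota 1 (minn k m), j <- iota 1 (minn h n)].

(* Main.v *)
Require Import Defs.
From HB Require Import structures.
From mathcomp Require Import all_boot all_order all_algebra.
From mathcomp Require Import perm mxtens zify ring.

Set Implicit Arguments.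
Unset Strict Implicit.
Unset Printing Implicit Defensive.

Import GRing.Theory.
Local Open Scope ring_scope.

(** Write x and y for the commuting matrices X *t 1 and 1 *t Y.  Similarities
    of X and Y tensor to a similarity of P(X, Y), so P(X, Y) is the direct sum
    of its values on pairs of Jordan blocks; the Jordan form is computed for
    one such pair, of sizes m and n and eigenvalues lambda != mu.

    Let nu be the slope (f(lambda) - f(mu)) / (lambda - mu).  Since
    phi(w) = f(w) - nu w takes the same value at lambda and mu,
<<
      (x - y) (P(x, y) - nu) = (phi(x) - phi(lambda)) - (phi(y) - phi(mu)).
>>
    Here x - y is invertible (triangular with diagonal lambda - mu) and commutes
    with P(x, y), so all powers of P - nu have the same ranks as the powers of
    the right-hand side (Pblock_slope, rank_mul_unit).  A nilpotent matrix is
    determined up to similarity by the ranks of its powers (jordan_dec_by_rank,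
    which rests on the existence of Jordan forms, nilp_jordan_dec), so it is
    enough to find the Jordan form of the right-hand side.

    By Taylor expansion at lambda, phi(x) - phi(lambda) is a unit times the k-th
    power of a nilpotent block; comparing ranks once more, its Jordan blocks are
    those of N_m ^+ k, whose sizes are the s_i (jordan_dec_poly_jordan).  In the
    same way phi(y) - phi(mu) has blocks of sizes t_j.  There remains
    N_s *t 1 - 1 *t N_t, which is multiplication by x - y on
    V(s, t) = F[x, y] / (x^s, y^t).  The derivation d/dx + d/dy kills x - y, so
    it defines a map V(s, t) -> V(s - 1, t - 1) commuting with multiplication
    by x - y.  In characteristic 0 it is onto, and its kernel is the cyclic
    module generated by 1, of dimension s + t - 1.  A cyclic submodule of
    maximal nilpotency order splits off (jordan_dec_split), and induction gives
    the Clebsch-Gordan sizes s + t - 1, s + t - 3, and so on (clebsch_gordan).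

    When lambda = mu or phi is constant nothing more than the existence of a
    Jordan form is asserted; it holds because P - nu is then still strictly
    upper triangular for some scalar nu (Pblock_jordan_form). *)

(** * Similarity and direct sums of matrices *)

Section DirectSums.
Variable F : fieldType.

(** A decomposition of the space into the images of the P i, with Q i the
    corresponding projections. *)
Definition resolution (I : finType) (m : nat) (p : I -> nat)
    (P : forall i, 'M[F]_(m, p i)) (Q : forall i, 'M[F]_(p i, m)) : Prop :=
  [/\ forall i, Q i *m P i = 1%:M,
      forall i j, i != j -> Q i *m P j = 0
    & \sum_i P i *m Q i = 1%:M].

(** A is similar to the block diagonal matrix of the B i.  Indexing the summands
    by an arbitrary finite type, and never forming the block matrix, avoids all
    casts between expressions of the same dimension. *)
Definition dsum (I : finType) (m : nat) (A : 'M[F]_m) (p : I -> nat)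
    (B : forall i, 'M[F]_(p i)) : Prop :=
  exists (P : forall i, 'M[F]_(m, p i)) (Q : forall i, 'M[F]_(p i, m)),
    resolution P Q /\ forall i, A *m P i = P i *m B i.

(** Similarity of matrices whose dimensions need not be syntactically equal. *)
Definition msim (m n : nat) (A : 'M[F]_m) (B : 'M[F]_n) : Prop :=
  exists (P : 'M[F]_(m, n)) (Q : 'M[F]_(n, m)),
    [/\ Q *m P = 1%:M, P *m Q = 1%:M & A *m P = P *m B].

Lemma msim_refl m (A : 'M[F]_m) : msim A A.
Proof. by exists 1%:M, 1%:M; rewrite !mulmx1 mul1mx. Qed.

Lemma msim_sym m n (A : 'M[F]_m) (B : 'M[F]_n) : msim A B -> msim B A.
Proof.
case=> P [Q [QP PQ AP]]; exists Q, P; split=> //.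
by rewrite -[B *m Q]mul1mx -QP -mulmxA !(mulmxA P) -AP -(mulmxA A) PQ mulmx1.
Qed.

Lemma similar_mxP m n (A : 'M[F]_m) (B : 'M[F]_n) :
  similar_mx A B <-> msim A B.
Proof.
split.
  case=> e; case: m / e A => A [P Pu]; rewrite /simmx_to_for /= castmx_id.
  rewrite mxpoly.conjumx // => /eqP <-.
  by exists (invmx P), P; rewrite ?mulVmx ?mulmxV // !mulmxA mulVmx ?mul1mx.
case=> P [Q [QP PQ AP]].
have le_dim a b (U : 'M[F]_(a, b)) (V : 'M_(b, a)) :
    U *m V = 1%:M -> (a <= b)%N.
  move=> UV; rewrite -(mxrank1 F a) -UV.
  by rewrite (leq_trans (mxrankM_maxl _ _)) ?rank_leq_col.
have e : n = m.
  by apply/eqP; rewrite eqn_leq (le_dim _ _ _ _ QP) (le_dim _ _ _ _ PQ).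
exists e; case: m / e A P Q AP QP PQ => A P Q AP QP PQ; rewrite castmx_id.
have [Pu Qu] := mulmx1_unit PQ.
have QA : Q *m A = B *m Q.
  by rewrite -[RHS]mul1mx -QP -mulmxA (mulmxA P) -AP -mulmxA PQ mulmx1.
exists Q => //; by rewrite /simmx_to_for /= mxpoly.conjumx // QA mulmxK.
Qed.

Lemma exp_intertwining m n (A : 'M[F]_m) (B : 'M[F]_n) (P : 'M[F]_(m, n)) r :
  A *m P = P *m B -> A ^+ r *m P = P *m B ^+ r.
Proof.
move=> AP; elim: r => [|r IHr]; first by rewrite mulmx1 mul1mx.
by rewrite [A ^+ _]exprS -mulmxE -mulmxA IHr mulmxA AP -mulmxA mulmxE -exprS.
Qed.

Lemma resolution_intertwining (I : finType) m (A : 'M[F]_m) (p : I -> nat)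
    (P : forall i, 'M[F]_(m, p i)) (Q : forall i, 'M[F]_(p i, m))
    (B : forall i, 'M[F]_(p i)) :
  resolution P Q -> (forall i, A *m P i = P i *m B i) ->
  forall i, Q i *m A = B i *m Q i.
Proof.
move=> [QP1 QP0 PQ] AP i; rewrite -[LHS]mulmx1 -PQ mulmx_sumr.
rewrite (bigD1 i) //= big1 ?addr0 => [|j ji].
  by rewrite mulmxA -(mulmxA (Q i)) AP mulmxA QP1 mul1mx.
by rewrite mulmxA -(mulmxA (Q i)) AP mulmxA QP0 1?eq_sym // !mul0mx.
Qed.

(** The similarity glues the isomorphisms between corresponding summands. *)
Lemma dsum_msim (I : finType) m n (A : 'M[F]_m) (A' : 'M[F]_n) (p : I -> nat)
    (B : forall i, 'M[F]_(p i)) :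
  dsum A B -> dsum A' B -> msim A A'.
Proof.
case=> P [Q [resPQ AP]] [P' [Q' [resPQ' AP']]].
have QA' := resolution_intertwining resPQ' AP'.
have [QP1 QP0 PQ] := resPQ; have [QP1' QP0' PQ'] := resPQ'.
have mixed k1 k2 k3 (U1 : forall i, 'M[F]_(k1, p i))
    (U2 : forall i, 'M[F]_(p i, k2)) (U3 : forall i, 'M[F]_(k2, p i))
    (U4 : forall i, 'M[F]_(p i, k3)) :
    (forall i, U2 i *m U3 i = 1%:M) ->
    (forall i j, i != j -> U2 i *m U3 j = 0) ->
    (\sum_i U1 i *m U2 i) *m (\sum_i U3 i *m U4 i) = \sum_i U1 i *m U4 i.
  move=> e1 e0; rewrite mulmx_suml; apply: eq_bigr => i _.
  rewrite mulmx_sumr (bigD1 i) //= big1 ?addr0 => [|j ji].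
    by rewrite -mulmxA (mulmxA (U2 i)) e1 mul1mx.
  by rewrite -mulmxA (mulmxA (U2 i)) e0 1?eq_sym // mul0mx mulmx0.
exists (\sum_i P i *m Q' i), (\sum_i P' i *m Q i); split; rewrite ?mixed //.
rewrite mulmx_sumr mulmx_suml; apply: eq_bigr => i _.
by rewrite mulmxA AP -!mulmxA QA'.
Qed.

Lemma dsum1 m n (A : 'M[F]_m) (B : 'M[F]_n) :
  msim A B <-> dsum A (fun _ : unit => B).
Proof.
split=> [[P [Q [QP PQ AP]]]|[P [Q [[QP _ PQ] AP]]]].
  exists (fun _ => P), (fun _ => Q); split=> //; split=> //.
  by rewrite (big_pred1 tt) //; case.
by exists (P tt), (Q tt); split; rewrite ?AP ?QP // -PQ (big_pred1 tt) //; case.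
Qed.

Lemma dsum_sigma (I : finType) (J : I -> finType) m (A : 'M[F]_m)
    (p : I -> nat) (q : forall i, J i -> nat)
    (B : forall i, 'M[F]_(p i)) (C : forall i j, 'M[F]_(q i j)) :
  dsum A B -> (forall i, dsum (B i) (C i)) ->
  dsum A (fun x : {i : I & J i} => C (tag x) (tagged x)).
Proof.
case=> P [Q [[QP1 QP0 PQ] AP]] /fin_all_exists[P' /fin_all_exists[Q']].
move=> /all_and2[res BP'].
exists (fun x => P (tag x) *m P' (tag x) (tagged x)),
  (fun x => Q' (tag x) (tagged x) *m Q (tag x)).
split; last by move=> x; rewrite mulmxA AP -!mulmxA BP'.
split.
- case=> i j /=; have [e1 e0 e] := res i.
  by rewrite mulmxA -(mulmxA (Q' i j)) QP1 mulmx1 e1.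
- case=> i j [i' j']; case: (eqVneq i i') j' => [<-|ii'] j' ne /=; last first.
    by rewrite mulmxA -(mulmxA (Q' i j)) QP0 // mulmx0 mul0mx.
  have [e1 e0 e] := res i.
  rewrite mulmxA -(mulmxA (Q' i j)) QP1 mulmx1 e0 //.
  by apply: contra_neq ne => ->.
rewrite -PQ.
rewrite -(sig_big_dep xpredT (fun _ => xpredT)
  (fun i j => P i *m P' i j *m (Q' i j *m Q i))) /=.
apply: eq_bigr => i _; have [e1 e0 e] := res i.
rewrite -[in RHS](mulmx1 (P i)) -e mulmx_sumr mulmx_suml.
by apply: eq_bigr => j _; rewrite !mulmxA.
Qed.

Lemma dsum_reindex (I J : finType) (g : J -> I) m (A : 'M[F]_m) (p : I -> nat)
    (B : forall i, 'M[F]_(p i)) :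
  bijective g -> dsum A B -> dsum A (fun j => B (g j)).
Proof.
move=> g_bij [P [Q [[QP1 QP0 PQ] AP]]].
exists (fun j => P (g j)), (fun j => Q (g j)); split=> //; split=> // [i j ij|].
  by apply: QP0; rewrite (bij_eq g_bij).
by rewrite -PQ [RHS](reindex g) //; apply: onW_bij.
Qed.

Lemma dsum_congr (I : finType) m (A : 'M[F]_m) (p q : I -> nat)
    (B : forall i, 'M[F]_(p i)) (C : forall i, 'M[F]_(q i)) :
  dsum A B -> (forall i, msim (B i) (C i)) -> dsum A C.
Proof.
case=> P [Q [[QP1 QP0 PQ] AP]] /fin_all_exists[U /fin_all_exists[V]].
move=> /all_and3[VU UV BU].
exists (fun i => P i *m U i), (fun i => V i *m Q i); split; last first.
  by move=> i; rewrite mulmxA AP -!mulmxA BU.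
split=> [i|i j ij|].
- by rewrite mulmxA -(mulmxA (V i)) QP1 mulmx1.
- by rewrite mulmxA -(mulmxA (V i)) QP0 // mulmx0 mul0mx.
rewrite -PQ; apply: eq_bigr => i _.
by rewrite mulmxA -(mulmxA (P i)) UV mulmx1.
Qed.

Lemma msim_dsum (I : finType) m n (A : 'M[F]_m) (A' : 'M[F]_n) (p : I -> nat)
    (B : forall i, 'M[F]_(p i)) :
  msim A A' -> dsum A' B -> dsum A B.
Proof.
move=> /dsum1 sAA' dA'.
have := dsum_sigma sAA' (fun _ => dA').
apply: (@dsum_reindex _ _ (fun i => existT _ tt i)).
by exists (fun x : {_ : unit & I} => tagged x) => [//|[[] j]].
Qed.

Lemma dsum_mxdiag n (p : 'I_n -> nat) (B : forall i, 'M[F]_(p i)) :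
  dsum (\mxdiag_i B i) B.
Proof.
pose P i : 'M[F]_(_, p i) := submxrow 1%:M i.
pose Q i : 'M[F]_(p i, _) := submxcol 1%:M i.
have rowP : \mxrow_i P i = 1%:M by rewrite submxrowK.
have colQ : \mxcol_i Q i = 1%:M by rewrite submxcolK.
have QP : \mxblock_(i, j) (Q i *m P j) = \mxdiag_i 1%:M.
  by rewrite -mul_mxcol_mxrow rowP colQ mulmx1 mxdiagZ.
exists P, Q; split.
  split=> [i|i j ij|].
  - by rewrite -(mxblockK (fun i j => Q i *m P j) i i) QP submxblock_diag.
  - rewrite -(mxblockK (fun i j => Q i *m P j) i j) QP mxblockK.
    by rewrite (negPf ij).
  by rewrite -mul_mxrow_mxcol rowP colQ mulmx1.
apply/eq_mxrowP; rewrite -mul_mxrow -mul_mxrow_mxdiag rowP.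
by rewrite mulmx1 mul1mx.
Qed.

Lemma dsum_mxdiagP n (p : 'I_n -> nat) (B : forall i, 'M[F]_(p i)) m
    (A : 'M[F]_m) :
  dsum A B <-> msim A (\mxdiag_i B i).
Proof.
split=> [dA|sA]; first exact: dsum_msim dA (dsum_mxdiag B).
exact: msim_dsum sA (dsum_mxdiag B).
Qed.

Lemma dsum_exp (I : finType) m (A : 'M[F]_m) (p : I -> nat)
    (B : forall i, 'M[F]_(p i)) r :
  dsum A B -> dsum (A ^+ r) (fun i => B i ^+ r).
Proof.
case=> P [Q [res AP]]; exists P, Q; split=> // i.
exact: exp_intertwining.
Qed.

Lemma dsum_scalar (I : finType) m (A : 'M[F]_m) (p : I -> nat)
    (B : forall i, 'M[F]_(p i)) c :
  dsum A B -> dsum (c%:M + A) (fun i => c%:M + B i).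
Proof.
case=> P [Q [res AP]]; exists P, Q; split=> // i.
by rewrite mulmxDl mulmxDr AP scalar_mxC.
Qed.

Lemma rank_msim m n (A : 'M[F]_m) (B : 'M[F]_n) :
  msim A B -> \rank A = \rank B.
Proof.
have le m' n' (A' : 'M[F]_m') (B' : 'M[F]_n') :
    msim A' B' -> (\rank A' <= \rank B')%N.
  case=> P [Q [QP PQ AP]]; rewrite -[A']mulmx1 -PQ mulmxA AP -mulmxA.
  by rewrite (leq_trans (mxrankM_maxr _ _)) ?mxrankM_maxl.
by move=> sAB; apply/eqP; rewrite eqn_leq !le //; apply: msim_sym.
Qed.

Lemma rank_dsum n (p : 'I_n -> nat) (B : forall i, 'M[F]_(p i)) m
    (A : 'M[F]_m) :
  dsum A B -> \rank A = (\sum_i \rank (B i))%N.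
Proof. by move=> /dsum_mxdiagP/rank_msim->; rewrite rank_mxdiag. Qed.

Lemma tens_scalar1 m n : (1%:M : 'M[F]_m) *t (1%:M : 'M[F]_n) = 1%:M.
Proof.
apply/matrixP => i j; case: (mxtens_indexP i) => i1 i2.
case: (mxtens_indexP j) => j1 j2; rewrite tensmxE !mxE.
by rewrite (can_eq (@mxtens_indexK _ _)) xpair_eqE -natrM mulnb.
Qed.

Lemma tens_suml m1 n1 m2 n2 (I : finType) (P : pred I)
    (A : I -> 'M[F]_(m1, n1)) (B : 'M[F]_(m2, n2)) :
  (\sum_(i | P i) A i) *t B = \sum_(i | P i) A i *t B.
Proof.
apply/matrixP => k l; rewrite !mxE !summxE mulr_suml.
by apply: eq_bigr => i _; rewrite mxE.
Qed.

Lemma tens_sumr m1 n1 m2 n2 (I : finType) (P : pred I)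
    (A : 'M[F]_(m1, n1)) (B : I -> 'M[F]_(m2, n2)) :
  A *t (\sum_(i | P i) B i) = \sum_(i | P i) A *t B i.
Proof.
apply/matrixP => k l; rewrite !mxE !summxE mulr_sumr.
by apply: eq_bigr => i _; rewrite mxE.
Qed.

(** A construction on pairs of matrices that commutes with tensor products of
    intertwining maps distributes over direct sums.  It is used both for P(X, Y)
    and for X *t 1 - 1 *t Y. *)
Lemma dsum_tens (G : forall m n, 'M[F]_m -> 'M[F]_n -> 'M[F]_(m * n)) :
  (forall m m' n n' (A : 'M_m) (A' : 'M_m') (B : 'M_n) (B' : 'M_n')
     (P : 'M_(m, m')) (Q : 'M_(n, n')), A *m P = P *m A' -> B *m Q = Q *m B' ->
     G m n A B *m (P *t Q) = (P *t Q) *m G m' n' A' B') ->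
  forall (I J : finType) m n (A : 'M_m) (B : 'M_n) (p : I -> nat)
    (q : J -> nat) (A' : forall i, 'M_(p i)) (B' : forall j, 'M_(q j)),
  dsum A A' -> dsum B B' ->
  dsum (G m n A B)
    (fun x : {i : I & J} => G _ _ (A' (tag x)) (B' (tagged x))).
Proof.
move=> G_nat I J m n A B p q A' B' [P [Q [[QP1 QP0 PQ] AP]]].
case=> P' [Q' [[QP1' QP0' PQ'] BP]].
exists (fun x => P (tag x) *t P' (tagged x)),
  (fun x => Q (tag x) *t Q' (tagged x)); split; last by move=> x; apply: G_nat.
split.
- by move=> x; rewrite tensmx_mul QP1 QP1' tens_scalar1.
- case=> i j [i' j'] ne; rewrite tensmx_mul /=.
  case: (eqVneq i i') ne => [<-|ii'] ne; last by rewrite QP0 // tens0mx.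
  by rewrite QP0' ?tensmx0 //; apply: contra_neq ne => ->.
rewrite -tens_scalar1 -PQ -PQ' tens_suml.
rewrite -(sig_big_dep xpredT (fun _ => xpredT)
  (fun i j => P i *t P' j *m (Q i *t Q' j))) /=.
apply: eq_bigr => i _; rewrite tens_sumr.
by apply: eq_bigr => j _; rewrite tensmx_mul.
Qed.

End DirectSums.

(** * Jordan forms of nilpotent matrices *)

Section NilpotentForms.
Variable F : fieldType.

(** A Jordan form in which blocks of size 0 are tolerated. *)
Definition jordan_dec (m : nat) (A : 'M[F]_m) (s : seq (F * nat)) : Prop :=
  dsum A (fun i : 'I_(size s) => jordan_block (blk i).2 (blk i).1).

Lemma jordan_formP m (A : 'M[F]_m) s :
  jordan_form A s <-> all (fun b => 0 < b.2)%N s /\ jordan_dec A s.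
Proof.
by split=> -[s_gt0]; split=> //; [apply/dsum_mxdiagP/similar_mxP
  |apply/similar_mxP/dsum_mxdiagP].
Qed.

(** Passing from any finite index type to lists up to permutation: this is where
    the order of the blocks is forgotten. *)
Lemma dsum_jordan_dec (T : finType) (l : T -> F * nat) m (A : 'M[F]_m) s :
  dsum A (fun x => jordan_block (l x).2 (l x).1) ->
  perm_eq s [seq l x | x <- enum T] -> jordan_dec A s.
Proof.
move=> dA ps.
have sz : size s = #|T| by rewrite (perm_size ps) size_map cardE.
have szt : size [seq l x | x <- enum T] == size s by rewrite (perm_size ps).
have [p /= Ds] : exists p : 'S_(size s),
    s = [tuple tnth (Tuple szt) (p i) | i < size s].
  exact/tuple_permP.
pose g (i : 'I_(size s)) : T := enum_val (cast_ord sz (p i)).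
have g_bij : bijective g.
  exists (fun x => (p^-1)%g (cast_ord (esym sz) (enum_rank x))) => x.
    by rewrite /g enum_valK cast_ordK permK.
  by rewrite /g permKV cast_ordKV enum_rankK.
have lg i : blk i = l (g i).
  rewrite /blk (_ : in_tuple s = [tuple tnth (Tuple szt) (p i) | i < size s]).
    2: exact: val_inj.
  have x0 := l (g i); rewrite tnth_mktuple.
  rewrite (tnth_nth x0) /= (nth_map (g i)) -?cardE -?sz //.
  by rewrite [in RHS]/g [in RHS](enum_val_nth (g i)).
apply: dsum_congr (dsum_reindex g_bij dA) _ => i.
by rewrite lg; apply: msim_refl.
Qed.

Lemma map_blk_enum (s : seq (F * nat)) :
  [seq blk i | i <- enum 'I_(size s)] = s.
Proof. exact: (map_tnth_enum (in_tuple s)). Qed.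

Lemma mem_blk (s : seq (F * nat)) (i : 'I_(size s)) : blk i \in s.
Proof. exact: (mem_tnth i (in_tuple s)). Qed.

Lemma blk_nilp (s : seq nat) (i : 'I_(size [seq ((0 : F), d) | d <- s])) :
  (blk i).1 = 0.
Proof. by have /mapP[d _ ->] := mem_blk i. Qed.

Lemma jordan_dec_perm m (A : 'M[F]_m) s t :
  perm_eq s t -> jordan_dec A t -> jordan_dec A s.
Proof.
by move=> st dA; apply: (dsum_jordan_dec dA); rewrite map_blk_enum.
Qed.

Lemma jordan_dec_flatten (I : finType) m (A : 'M[F]_m) (p : I -> nat)
    (B : forall i, 'M[F]_(p i)) (s : I -> seq (F * nat)) :
  dsum A B -> (forall i, jordan_dec (B i) (s i)) ->
  jordan_dec A (flatten [seq s i | i <- enum I]).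
Proof.
move=> dA dB; apply: (dsum_jordan_dec (dsum_sigma dA dB)).
suff -> : [seq blk (tagged x) | x <- enum {: {i : I & 'I_(size (s i))}}] =
    flatten [seq s i | i <- enum I] by [].
rewrite !enumT [in LHS]unlock /= /tag_enum map_flatten -!map_comp.
congr (flatten _); apply: eq_map => i /=.
by rewrite -map_comp -enumT -[RHS]map_blk_enum; apply: eq_map.
Qed.

Lemma jordan_dec1 m (c : F) : jordan_dec (jordan_block m c) [:: (c, m)].
Proof.
apply: (@dsum_jordan_dec unit (fun _ => (c, m))); first exact/dsum1/msim_refl.
by rewrite enumT unlock.
Qed.

Lemma jordan_dec_dim0 m (A : 'M[F]_m) : m = 0%N -> jordan_dec A [::].
Proof.
move=> m0; subst m; exists (fun=> 0), (fun=> 0).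
by split=> [|[]//]; split=> [[]//|[]//|]; rewrite [LHS]flatmx0 [RHS]flatmx0.
Qed.

Lemma jordan_block0 m : jordan_block m (0 : F) = nilp_mx m.
Proof. by rewrite /jordan_block raddf0 add0r. Qed.

Lemma jordan_dec_scalar m (A : 'M[F]_m) (c : F) (s : seq nat) :
  jordan_dec A [seq (0, d) | d <- s] ->
  jordan_dec (c%:M + A) [seq (c, d) | d <- s].
Proof.
move=> /(@dsum_scalar _ _ _ _ _ _ c) dA.
pose l (i : 'I_(size [seq ((0 : F), d) | d <- s])) := (c, (blk i).2).
apply: (@dsum_jordan_dec _ l).
  apply: dsum_congr dA _ => i; rewrite /jordan_block addrA -raddfD /=.
  by rewrite blk_nilp addr0; apply: msim_refl.
have := map_blk_enum [seq ((0 : F), d) | d <- s].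
move=> /(congr1 (map (fun b => (c, b.2)))) /=.
by rewrite -!map_comp => ->.
Qed.

(** Two invariant families of columns which together form a basis.  A left factor
    making row_mx P1 P2 invertible witnesses this, the matrix being square. *)
Lemma jordan_dec_cat m a b (A : 'M[F]_m) (B1 : 'M[F]_a) (B2 : 'M[F]_b)
    (P1 : 'M[F]_(m, a)) (P2 : 'M[F]_(m, b)) s1 s2 :
  m = (a + b)%N -> (exists L : 'M_(a + b, m), L *m row_mx P1 P2 \in unitmx) ->
  A *m P1 = P1 *m B1 -> A *m P2 = P2 *m B2 ->
  jordan_dec B1 s1 -> jordan_dec B2 s2 ->
  jordan_dec A (s1 ++ s2).
Proof.
move=> Dm; subst m => -[L].
set W := row_mx P1 P2; rewrite unitmx_mul => /andP[_ Wu] AP1 AP2 d1 d2.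
pose Q1 := usubmx (invmx W); pose Q2 := dsubmx (invmx W).
have DL : invmx W = col_mx Q1 Q2 by rewrite vsubmxK.
have := mulVmx Wu; rewrite DL mul_col_row scalar_mx_block.
move=> /eq_block_mx[e11 e12 e21 e22].
have := mulmxV Wu; rewrite DL mul_row_col => e1.
pose p (x : bool) := if x then a else b.
pose B x : 'M[F]_(p x) := if x as y return 'M[F]_(p y) then B1 else B2.
pose s (x : bool) := if x then s1 else s2.
have -> : s1 ++ s2 = flatten [seq s x | x <- enum {: bool}].
  by rewrite enumT unlock /= cats0.
apply: (@jordan_dec_flatten _ _ _ p B s); last by case.
exists (fun x => if x as y return 'M[F]_(_, p y) then P1 else P2).
exists (fun x => if x as y return 'M[F]_(p y, _) then Q1 else Q2).
split; last by case.
split; [by case|by case=> -[]|].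
by rewrite big_bool.
Qed.

(** The rows v, v A, v A^2, and so on. *)
Definition krylov m (v : 'rV[F]_m) (A : 'M[F]_m) N : 'M[F]_(N, m) :=
  \matrix_(i < N) (v *m A ^+ i).

(** The columns A^(N-1) x, down to A x and x: with this decreasing order, A acts
    on them by nilp_mx N itself rather than by its transpose. *)
Definition dual_krylov m (x : 'cV[F]_m) (A : 'M[F]_m) N : 'M[F]_(m, N) :=
  \matrix_(i < m, j < N) (A ^+ (N.-1 - j) *m x) i 0.

Lemma krylov_dual m (v : 'rV[F]_m) (x : 'cV[F]_m) (A : 'M[F]_m) N i j :
  (krylov v A N.+1 *m dual_krylov x A N.+1) i j
    = (v *m A ^+ (i + (N - j)) *m x) 0 0.
Proof.
rewrite exprD -mulmxE mulmxA -(mulmxA _ _ x) !mxE.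
by apply: eq_bigr => k _; rewrite !mxE.
Qed.

(** For x chosen with v A^N x != 0, the pairing of the chain of v with the chain
    of x is triangular, with the constant v A^N x on the diagonal. *)
Lemma krylov_dual_unit m (v : 'rV[F]_m) (A : 'M[F]_m) N :
  A ^+ N.+1 = 0 -> v *m A ^+ N != 0 ->
  exists x : 'cV[F]_m, krylov v A N.+1 *m dual_krylov x A N.+1 \in unitmx.
Proof.
move=> AN /rV0Pn[k vk]; exists (delta_mx k 0).
rewrite -unitmx_tr unitmxE det_trig.
  rewrite unitfE; apply/prodf_neq0 => i _.
  by rewrite mxE krylov_dual subnKC -1?ltnS // -colE mxE.
apply/is_trig_mxP => i j ij; rewrite mxE krylov_dual.
(* Below the diagonal the exponent exceeds N. *)
rewrite (_ : j + (N - i) = (j - i.+1) + N.+1)%N; last first.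
  by have := ltn_ord i; lia.
by rewrite exprD AN mulr0 mulmx0 mul0mx mxE.
Qed.

Lemma dual_krylov_nilp m (x : 'cV[F]_m) (A : 'M[F]_m) N :
  A ^+ N.+1 = 0 ->
  A *m dual_krylov x A N.+1 = dual_krylov x A N.+1 *m nilp_mx N.+1.
Proof.
move=> AN; apply/matrixP => i j.
have -> : (A *m dual_krylov x A N.+1) i j = (A ^+ (N - j).+1 *m x) i 0.
  by rewrite exprS -mulmxE -mulmxA !mxE; apply: eq_bigr => k _; rewrite !mxE.
rewrite [RHS]mxE; case: (unliftP ord0 j) => [j'|] ->; last first.
  rewrite subn0 AN mul0mx mxE big1 // => k _.
  by rewrite !mxE mulr0.
rewrite (bigD1 (widen_ord (leqnSn _) j')) //= big1 ?addr0 => [|k kj].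
  by rewrite !mxE /= eqxx mulr1 /bump leq0n subnSK.
rewrite [X in _ * X]mxE /= /bump leq0n add1n eqSS.
rewrite (_ : (_ == _) = false) ?mulr0 //.
by apply/eqP => jk; case/eqP: kj; apply: val_inj.
Qed.

(** A cyclic subspace of maximal nilpotency order is a direct summand.  The
    subspace is spanned by the v A^i, and S is the projection to the quotient by
    it, on which A induces B.  If the pairing v A^N x is not zero, the vectors
    annihilated by all columns A^i x form an invariant complement, so that these
    columns together with S are the new coordinates: no Jordan chain has to be
    lifted from the quotient. *)
Lemma jordan_dec_split m n (A : 'M[F]_m) (B : 'M[F]_n) (S : 'M[F]_(m, n))
    (R : 'M[F]_(n, m)) (v : 'rV[F]_m) N s :
  m = (N.+1 + n)%N -> A ^+ N.+1 = 0 -> v *m A ^+ N != 0 -> v *m S = 0 ->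
  R *m S = 1%:M -> A *m S = S *m B -> jordan_dec B s ->
  jordan_dec A ((0, N.+1) :: s).
Proof.
move=> Dm AN vN vS RS AS dB.
have [x KXu] := krylov_dual_unit AN vN.
set K := krylov _ _ _ in KXu; set X := dual_krylov _ _ _ in KXu.
have AX : A *m X = X *m nilp_mx N.+1 by apply: dual_krylov_nilp.
have KS : K *m S = 0.
  apply/row_matrixP => i; rewrite row_mul rowK -mulmxA.
  by rewrite (exp_intertwining i AS) mulmxA vS mul0mx row0.
apply: (@jordan_dec_cat m N.+1 n A (nilp_mx N.+1) B X S [:: (0, N.+1)] s) => //.
  exists (col_mx K R); rewrite mul_col_row KS RS unitmxE det_lblock det1 mulr1.
  by rewrite -unitmxE.
by rewrite -jordan_block0; apply: jordan_dec1.
Qed.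

(** Induction on the dimension: if N.+1 is the nilpotency order of A, some basis
    vector v has v A^N != 0, and jordan_dec_split applies to its chain. *)
Lemma nilp_jordan_dec m (A : 'M[F]_m) r : A ^+ r = 0 ->
  exists s, all (fun d => 0 < d)%N s /\ jordan_dec A [seq (0, d) | d <- s].
Proof.
elim/ltn_ind: m A r => m IHm A r Ar; case: (posnP m) => [m0|m_gt0].
  by exists [::]; split=> //; apply: jordan_dec_dim0.
have exN : exists r, A ^+ r == 0 by exists r; rewrite Ar.
case: (ex_minnP exN) => -[|N] /eqP AN minN.
  case: m m_gt0 A {IHm Ar exN minN} AN => // m _ A /matrixP/(_ ord0 ord0)/eqP.
  by rewrite !mxE oner_eq0.
have [i vN] : exists i, row i (A ^+ N) != 0.
  apply/existsP; apply: contraTT (leqnn N) => /existsPn A0; rewrite -ltnNge.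
  apply: minN; apply/eqP/row_matrixP => i; rewrite row0.
  by apply/eqP; have := A0 i; rewrite negbK.
rewrite rowE in vN; set v := delta_mx _ _ in vN.
have [x KXu] := krylov_dual_unit AN vN.
set K := krylov _ _ _ in KXu; set X := dual_krylov _ _ _ in KXu.
have rK : \rank K = N.+1.
  apply/eqP; rewrite eqn_leq rank_leq_row -{1}(mxrank_unit KXu).
  exact: mxrankM_maxl.
pose n := \rank (kermx K^T).
have Dm : m = (N.+1 + n)%N.
  by rewrite /n mxrank_ker mxrank_tr rK subnKC // -rK rank_leq_col.
(* The columns of S are a basis of the column vectors annihilated by K. *)
pose S' := row_base (kermx K^T); pose S : 'M[F]_(m, n) := S'^T.
have KS : K *m S = 0.
  by apply: trmx_inj; rewrite trmx_mul trmxK trmx0; apply/sub_kermxP;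
     rewrite eq_row_base.
pose R := (pinvmx S')^T.
have RS : R *m S = 1%:M.
  by rewrite /R /S -trmx_mul mulmxVp ?trmx1 ?row_base_free.
have [D AS] : exists D, A *m S = S *m D.
  have KA : (K *m A) *m S = 0.
    apply/row_matrixP => j; rewrite !row_mul rowK -[_ *m A]mulmxA mulmxE.
    rewrite -exprSr row0; have := ltn_ord j; rewrite ltnS leq_eqVlt.
    case/predU1P => [->|jN]; first by rewrite AN mulmx0 mul0mx.
    by have /row_matrixP/(_ (Ordinal (jN : (j.+1 < N.+1)%N))) := KS;
      rewrite row_mul rowK row0.
  have : (S' *m A^T <= S')%MS.
    rewrite eq_row_base; apply/sub_kermxP; apply: trmx_inj.
    by rewrite [LHS]trmx_mul trmxK (trmx_mul S') trmxK trmx0 mulmxA; exact: KA.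
  case/submxP => D SD; exists D^T; apply: trmx_inj.
  by rewrite [LHS]trmx_mul [RHS]trmx_mul !trmxK.
have DN : D ^+ N.+1 = 0.
  by rewrite -[LHS]mul1mx -RS -mulmxA -(exp_intertwining _ AS) AN mul0mx mulmx0.
have [|s [s_gt0 ds]] := IHm n _ D N.+1 DN.
  by rewrite [X in (_ < X)%N]Dm; lia.
exists (N.+1 :: s); split=> //=.
apply: (jordan_dec_split Dm AN vN _ RS AS ds).
by have /row_matrixP/(_ ord0) := KS; rewrite row_mul rowK row0 expr0 mulmx1.
Qed.

Lemma nilp_mx_expE m r i j :
  (nilp_mx m ^+ r : 'M[F]_m) i j = (j == i + r :> nat)%N%:R.
Proof.
elim: r i j => [|r IHr] i j; first by rewrite expr0 mxE addn0 eq_sym.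
rewrite exprS -mulmxE mxE.
case: (ltnP i.+1 m) => [im|im].
  rewrite (bigD1 (Ordinal im)) //= big1 ?addr0 => [|k ki].
    by rewrite mxE eqxx mul1r IHr addSnnS.
  rewrite mxE (_ : (_ == _) = false) ?mul0r //.
  by apply/eqP => ki'; case/eqP: ki; apply: val_inj.
rewrite big1 => [|k _]; last first.
  by rewrite mxE (_ : (_ == _) = false) ?mul0r //; have := ltn_ord k; lia.
by rewrite (_ : (_ == _) = false) //; have := ltn_ord j; lia.
Qed.

(** The r-th power is the composite of a truncation of rank m - r and a shift of
    rank m - r, which have one-sided inverses. *)
Lemma rank_nilp_mx m r : \rank (nilp_mx m ^+ r : 'M[F]_m) = (m - r)%N.
Proof.
pose C : 'M[F]_(m, m - r) := \matrix_(i, j) (i == j :> nat)%:R.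
pose D : 'M[F]_(m - r, m) := \matrix_(i, j) (j == (i + r)%N :> nat)%:R.
have lt_m (k : 'I_(m - r)) : (k + r < m)%N by have := ltn_ord k; lia.
have DC : nilp_mx m ^+ r = C *m D.
  apply/matrixP => i j; rewrite nilp_mx_expE mxE.
  case: (ltnP i (m - r)) => [im|im].
    rewrite (bigD1 (Ordinal im)) //= big1 ?addr0 => [|k ki].
      by rewrite !mxE eqxx mul1r.
    rewrite mxE (_ : (_ == _) = false) ?mul0r //.
    by apply/eqP => ki'; case/eqP: ki; apply: val_inj.
  rewrite big1 => [|k _].
    by rewrite (_ : (_ == _) = false) //; have := ltn_ord j; lia.
  by rewrite mxE (_ : (_ == _) = false) ?mul0r //; have := ltn_ord k; lia.
have CC : C^T *m C = 1%:M.
  apply/matrixP => i j; rewrite !mxE.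
  have im : (i < m)%N by have := ltn_ord i; lia.
  rewrite (bigD1 (Ordinal im)) //= big1 ?addr0 => [|k ki].
    by rewrite !mxE eqxx mul1r.
  rewrite !mxE (_ : (k == i :> nat) = false) ?mul0r //.
  by apply/eqP => ki'; case/eqP: ki; apply: val_inj.
have DD : D *m D^T = 1%:M.
  apply/matrixP => i j; rewrite !mxE.
  rewrite (bigD1 (Ordinal (lt_m i))) //= big1 ?addr0 => [|k ki].
    by rewrite !mxE eqxx mul1r eqn_add2r.
  rewrite !mxE (_ : (k == i + r :> nat)%N = false) ?mul0r //.
  by apply/eqP => ki'; case/eqP: ki; apply: val_inj.
apply/eqP; rewrite eqn_leq; apply/andP; split.
  by rewrite DC (leq_trans (mxrankM_maxl _ _)) ?rank_leq_col.
rewrite -[X in (X <= _)%N](mxrank1 F).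
rewrite -[1%:M]mulmx1 -{1}CC -DD -mulmxA (mulmxA C) -DC.
exact: leq_trans (mxrankM_maxr _ _) (mxrankM_maxl _ _).
Qed.

Lemma rank_jordan_dec m (A : 'M[F]_m) s r :
  jordan_dec A [seq (0, d) | d <- s] ->
  \rank (A ^+ r) = (\sum_(d <- s) (d - r))%N.
Proof.
move=> dA; rewrite (rank_dsum (dsum_exp r dA)).
transitivity (\sum_(b <- [seq ((0%R : F), d) | d <- s]) (b.2 - r))%N.
  rewrite [RHS]big_tnth; apply: eq_bigr => i _.
  by rewrite -/(blk i) blk_nilp jordan_block0 rank_nilp_mx.
by rewrite big_map.
Qed.

(** The second difference of the rank function at k is the number of blocks of
    size k + 1. *)
Lemma perm_eq_rank (s t : seq nat) :
  all (fun d => 0 < d)%N s -> all (fun d => 0 < d)%N t ->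
  (forall r, \sum_(d <- s) (d - r) = \sum_(d <- t) (d - r))%N -> perm_eq s t.
Proof.
move=> s_gt0 t_gt0 st.
have diff2 u k : (\sum_(d <- u) (d - k) + \sum_(d <- u) (d - k.+2) =
    2 * \sum_(d <- u) (d - k.+1) + count_mem k.+1 u)%N.
  elim: u => [|d u IHu]; rewrite ?big_nil // !big_cons [count _ _]/=.
  move: IHu; move: (\sum_(j <- u) _)%N (\sum_(j <- u) _)%N (\sum_(j <- u) _)%N.
  by move: (count_mem _ _) => a b c e; case: eqP; lia.
have no0 u : all (fun d => 0 < d)%N u -> count_mem 0%N u = 0%N.
  by move=> u_gt0; apply/count_memPn/negP => /(allP u_gt0).
apply/allP => -[|k] _ /=; first by rewrite !no0.
have := diff2 s k; rewrite !st (diff2 t k) => /addnI e.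
by apply/eqP/esym.
Qed.

(** The power of A of exponent \sum_(d <- s) d has rank 0, so A is nilpotent and
    has a Jordan form; the ranks identify its block sizes. *)
Lemma jordan_dec_by_rank m (A : 'M[F]_m) (s : seq nat) :
  all (fun d => 0 < d)%N s ->
  (forall r, \rank (A ^+ r) = \sum_(d <- s) (d - r))%N ->
  jordan_dec A [seq (0, d) | d <- s].
Proof.
move=> s_gt0 rA.
have [|t [t_gt0 dt]] := @nilp_jordan_dec m A (\sum_(d <- s) d).
  apply/eqP; rewrite -mxrank_eq0 rA big_seq big1 // => d ds.
  by apply/eqP; rewrite subn_eq0 (big_rem d) //= leq_addr.
apply: (jordan_dec_perm _ dt); apply/perm_map/perm_eq_rank => // r.
by rewrite -rA (rank_jordan_dec r dt).
Qed.

End NilpotentForms.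

(** * Upper triangular matrices with constant diagonal *)

Section Triangular.
Variable F : fieldType.

(** This class contains the Jordan blocks and is closed under polynomial
    operations and tensor products; its members are c plus a nilpotent. *)
Definition const_uptri (m : nat) (c : F) (A : 'M[F]_m) : Prop :=
  forall i j : 'I_m, (j <= i)%N -> A i j = c *+ (i == j).

Lemma const_uptri_scalar m c : const_uptri c (c%:M : 'M_m).
Proof. by move=> i j _; rewrite mxE. Qed.

Lemma const_uptriD m a b (A B : 'M[F]_m) :
  const_uptri a A -> const_uptri b B -> const_uptri (a + b) (A + B).
Proof. by move=> tA tB i j ji; rewrite mxE tA // tB // mulrnDl. Qed.

Lemma const_uptriZ m a c (A : 'M[F]_m) :
  const_uptri a A -> const_uptri (c * a) (c *: A).
Proof. by move=> tA i j ji; rewrite mxE tA // mulrnAr. Qed.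

Lemma const_uptriM m a b (A B : 'M[F]_m) :
  const_uptri a A -> const_uptri b B -> const_uptri (a * b) (A *m B).
Proof.
move=> tA tB i j ji; rewrite mxE (bigD1 i) //= big1 ?addr0 => [|k ki].
  by rewrite tA // tB // eqxx mulr1n mulrnAr.
case: (leqP k i) => [ki'|ik]; first by rewrite tA // eq_sym (negPf ki) mul0r.
rewrite tB; last exact: leq_trans ji (ltnW ik).
by rewrite (_ : k == j = false) ?mulr0 // -val_eqE /=; lia.
Qed.

Lemma const_uptriX m a (A : 'M[F]_m) r :
  const_uptri a A -> const_uptri (a ^+ r) (A ^+ r).
Proof.
move=> tA; elim: r => [|r IHr]; first exact: const_uptri_scalar.
by rewrite !exprS; apply: const_uptriM.
Qed.

Lemma const_uptri_sum m (I : Type) (r : seq I) (c : I -> F) (A : I -> 'M[F]_m) :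
  (forall i, const_uptri (c i) (A i)) ->
  const_uptri (\sum_(i <- r) c i) (\sum_(i <- r) A i).
Proof.
move=> tA; apply: (big_rec2 (fun x y => const_uptri y x)) => [i j _|i x y _ t].
  by rewrite mxE mul0rn.
exact: const_uptriD.
Qed.

(** The index of a tensor product is ordered lexicographically. *)
Lemma const_uptri_tens m n a b (A : 'M[F]_m) (B : 'M[F]_n) :
  const_uptri a A -> const_uptri b B -> const_uptri (a * b) (A *t B).
Proof.
move=> tA tB i j; case: (mxtens_indexP i) => i1 i2.
case: (mxtens_indexP j) => j1 j2 /= ji.
rewrite tensmxE (can_eq (@mxtens_indexK _ _)) xpair_eqE.
have ji1 : (j1 <= i1)%N.
  by have := ltn_ord i2; have := ltn_ord j2; move: ji; clear; nia.
rewrite tA //; case: (eqVneq i1 j1) ji => [<-|_] ji; last by rewrite mul0r.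
by rewrite tB ?mulr1n ?mulrnAr //; move: ji; rewrite leq_add2l.
Qed.

(** In the lexicographic order, strict triangularity of the first factor is
    enough. *)
Lemma const_uptri0_tensl m n (A : 'M[F]_m) (B : 'M[F]_n) :
  const_uptri 0 A -> const_uptri 0 (A *t B).
Proof.
move=> tA i j; case: (mxtens_indexP i) => i1 i2.
case: (mxtens_indexP j) => j1 j2 /= ji.
rewrite tensmxE tA ?mul0rn ?mul0r //.
by have := ltn_ord i2; have := ltn_ord j2; move: ji; clear; nia.
Qed.

Lemma const_uptri_unit m c (A : 'M[F]_m) :
  const_uptri c A -> c != 0 -> A \in unitmx.
Proof.
move=> tA c0; rewrite -unitmx_tr unitmxE det_trig.
  rewrite unitfE; apply/prodf_neq0 => i _.
  by rewrite mxE tA // eqxx.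
apply/is_trig_mxP => i j ij; rewrite mxE tA; last exact: ltnW.
by rewrite -val_eqE /= gtn_eqF.
Qed.

Lemma const_uptri_nilp m (A : 'M[F]_m) : const_uptri 0 A -> A ^+ m = 0.
Proof.
move=> tA; have AE r (i j : 'I_m) : (j < i + r)%N -> (A ^+ r) i j = 0.
  elim: r i j => [|r IHr] i j ji.
    by rewrite expr0 mxE -val_eqE /= gtn_eqF //; move: ji; rewrite addn0.
  rewrite exprS -mulmxE mxE big1 // => k _; case: (leqP k i) => [ki|ik].
    by rewrite tA // mul0rn mul0r.
  by rewrite IHr ?mulr0 //; move: ji ik; clear; lia.
by apply/matrixP => i j; rewrite AE ?mxE // ltn_addl.
Qed.

Lemma const_uptri_jordan m c : const_uptri c (jordan_block m c : 'M[F]_m).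
Proof.
move=> i j ji; rewrite !mxE (_ : (_ == _ :> nat) = false) ?addr0 //.
by move: ji; clear; lia.
Qed.

End Triangular.

(** * The difference of two nilpotent blocks on a tensor product *)

Section ClebschGordan.
Variable F : fieldType.

Definition kron_diff (m n : nat) (A : 'M[F]_m) (B : 'M[F]_n) : 'M[F]_(m * n) :=
  A *t 1%:M - 1%:M *t B.

Lemma tensDl m n p q (A A' : 'M[F]_(m, n)) (B : 'M[F]_(p, q)) :
  (A + A') *t B = A *t B + A' *t B.
Proof. by apply/matrixP => i j; rewrite !mxE mulrDl. Qed.

Lemma tensDr m n p q (A : 'M[F]_(m, n)) (B B' : 'M[F]_(p, q)) :
  A *t (B + B') = A *t B + A *t B'.
Proof. by apply/matrixP => i j; rewrite !mxE mulrDr. Qed.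

Lemma tensZl m n p q c (A : 'M[F]_(m, n)) (B : 'M[F]_(p, q)) :
  (c *: A) *t B = c *: (A *t B).
Proof. by apply/matrixP => i j; rewrite !mxE mulrA. Qed.

Lemma tensZr m n p q c (A : 'M[F]_(m, n)) (B : 'M[F]_(p, q)) :
  A *t (c *: B) = c *: (A *t B).
Proof. by apply/matrixP => i j; rewrite !mxE mulrCA. Qed.

Lemma tensBl m n p q (A A' : 'M[F]_(m, n)) (B : 'M[F]_(p, q)) :
  (A - A') *t B = A *t B - A' *t B.
Proof. by apply/matrixP => i j; rewrite !mxE mulrBl. Qed.

Lemma tensBr m n p q (A : 'M[F]_(m, n)) (B B' : 'M[F]_(p, q)) :
  A *t (B - B') = A *t B - A *t B'.
Proof. by apply/matrixP => i j; rewrite !mxE mulrBr. Qed.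

Lemma tens_exp m n (A : 'M[F]_m) (B : 'M[F]_n) r :
  (A *t B) ^+ r = (A ^+ r) *t (B ^+ r).
Proof.
elim: r => [|r IHr]; first by rewrite !expr0 tens_scalar1.
by rewrite !exprS IHr -!mulmxE tensmx_mul.
Qed.

Lemma tens_expl m n (A : 'M[F]_m) r :
  (A *t (1%:M : 'M_n)) ^+ r = A ^+ r *t 1%:M.
Proof. by rewrite tens_exp expr1n. Qed.

Lemma tens_expr m n (B : 'M[F]_n) r :
  ((1%:M : 'M_m) *t B) ^+ r = 1%:M *t B ^+ r.
Proof. by rewrite tens_exp expr1n. Qed.

Lemma tens_comm m n (A : 'M[F]_m) (B : 'M[F]_n) :
  GRing.comm (A *t 1%:M) (1%:M *t B).
Proof. by rewrite /GRing.comm -!mulmxE !tensmx_mul !mulmx1 !mul1mx. Qed.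

Lemma kron_diff_natural m m' n n' (A : 'M_m) (A' : 'M_m')
    (B : 'M_n) (B' : 'M_n') (P : 'M_(m, m')) (Q : 'M_(n, n')) :
  A *m P = P *m A' -> B *m Q = Q *m B' ->
  kron_diff A B *m (P *t Q) = (P *t Q) *m kron_diff A' B'.
Proof.
move=> AP BQ; rewrite mulmxBl mulmxBr !tensmx_mul.
by rewrite AP BQ !mulmx1 !mul1mx.
Qed.

(** The derivation F[X]/(X^(m+1)) -> F[X]/(X^m), in the bases of monomials. *)
Definition deriv_mx m : 'M[F]_(m.+1, m) :=
  \matrix_(i, j) (i%:R *+ (i == j.+1 :> nat)).

(** The quotient map F[X]/(X^(m+1)) -> F[X]/(X^m). *)
Definition trunc_mx m : 'M[F]_(m.+1, m) :=
  \matrix_(i, j) (i == j :> nat)%:R.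

(** The primitive without constant term, a right inverse of the derivation when
    the characteristic is 0. *)
Definition prim_mx m : 'M[F]_(m, m.+1) :=
  \matrix_(i, j) (i.+1%:R^-1 *+ (j == i.+1 :> nat)).

Lemma nilp_trunc_mx m : nilp_mx m.+1 *m trunc_mx m = trunc_mx m *m nilp_mx m.
Proof.
apply/matrixP => i j; rewrite [LHS]mxE [RHS]mxE.
transitivity ((j == i.+1 :> nat)%:R : F).
  rewrite (bigD1 (widen_ord (leqnSn m) j)) //= big1 ?addr0 => [|k kj].
    by rewrite !mxE eqxx mulr1.
  by rewrite [X in _ * X]mxE -val_eqE /= in kj *; rewrite (negPf kj) mulr0.
case: (ltnP i m) => [im|mi].
  rewrite (bigD1 (Ordinal im)) //= big1 ?addr0 => [|k ki].
    by rewrite !mxE eqxx mul1r.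
  rewrite mxE eq_sym -val_eqE /= in ki *.
  by rewrite (negPf ki) mul0r.
rewrite big1 => [|k _].
  by rewrite (_ : _ == _ = false) //; have := ltn_ord j; lia.
by rewrite mxE (_ : _ == _ = false) ?mul0r //; have := ltn_ord k; lia.
Qed.

(** The Leibniz rule d(X p) = X dp + p: nilp_mx is multiplication by X. *)
Lemma nilp_deriv_mx m :
  nilp_mx m.+1 *m deriv_mx m = deriv_mx m *m nilp_mx m + trunc_mx m.
Proof.
apply/matrixP => i j; rewrite [RHS]mxE.
have -> : (nilp_mx m.+1 *m deriv_mx m) i j = (i == j :> nat)%:R * i.+1%:R.
  rewrite mxE; case: (eqVneq (i : nat) j) => ij.
    have im : (i.+1 < m.+1)%N by rewrite ij ltnS.
    rewrite (bigD1 (Ordinal im)) //= big1 ?addr0 => [|k ki].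
      by rewrite !mxE /= ij !eqxx !mul1r.
    rewrite mxE -val_eqE /= in ki *.
    by rewrite (negPf ki) mul0r.
  rewrite mul0r big1 // => k _; rewrite !mxE.
  case: eqP => [->|_]; last by rewrite mul0r.
  by rewrite eqSS (negPf ij) mulr0.
have -> : (deriv_mx m *m nilp_mx m) i j = (i == j :> nat)%:R * i%:R.
  rewrite mxE; case: (posnP j) => [j0|j_gt0].
    rewrite big1 => [|k _].
      by rewrite j0; case: eqP => [->|]; rewrite ?mulr0 ?mul0r.
    by rewrite [X in _ * X]mxE j0 mulr0.
  have jm : (j.-1 < m)%N by have := ltn_ord j; lia.
  rewrite (bigD1 (Ordinal jm)) //= big1 ?addr0 => [|k kj].
    by rewrite !mxE /= prednK // eqxx mulr1 mulr_natl.
  rewrite [X in _ * X]mxE -val_eqE /= in kj *.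
  rewrite (_ : _ == _ = false) ?mulr0 //.
  by move: kj j_gt0; clear; lia.
by rewrite mxE -natr1 mulrDr mulr1.
Qed.

Lemma natf_neq0 (charF0 : [pchar F] =i pred0) k : (0 < k)%N -> (k%:R : F) != 0.
Proof. by have /pcharf0P-> := charF0; rewrite lt0n. Qed.

Lemma prim_mx_deriv_mx (charF0 : [pchar F] =i pred0) m :
  prim_mx m *m deriv_mx m = 1%:M.
Proof.
apply/matrixP => i j; rewrite !mxE.
rewrite (bigD1 (lift ord0 i)) //= big1 ?addr0 => [|k ki].
  by rewrite !mxE /= /bump leq0n eqxx eqSS val_eqE mulr1n mulrnAr mulVf
    ?(natf_neq0 charF0).
rewrite mxE (_ : _ == _ = false) ?mul0r //.
by move: ki; rewrite -val_eqE /= /bump leq0n => /negPf.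
Qed.

Lemma const_uptri_prim_mx_trunc_mx m : const_uptri 0 (prim_mx m *m trunc_mx m).
Proof.
move=> i j ji; rewrite mul0rn mxE big1 // => k _; rewrite !mxE.
case: eqP => [->|_]; last by rewrite mul0r.
by rewrite (_ : _ == _ = false) ?mulr0 //; move: ji; clear; lia.
Qed.

Lemma tr_trunc_mx_trunc_mx m : (trunc_mx m)^T *m trunc_mx m = 1%:M.
Proof.
apply/matrixP => i j; rewrite !mxE.
rewrite (bigD1 (widen_ord (leqnSn m) i)) //= big1 ?addr0 => [|k ki].
  by rewrite !mxE eqxx mul1r.
by rewrite !mxE -val_eqE /= in ki *; rewrite (negPf ki) mul0r.
Qed.

Lemma nilp_mx_exp0 m r : (m <= r)%N -> nilp_mx m ^+ r = 0 :> 'M[F]_m.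
Proof. by move=> mr; apply/eqP; rewrite -mxrank_eq0 rank_nilp_mx subn_eq0. Qed.

Lemma kron_diff_exp m n (A : 'M[F]_m) (B : 'M[F]_n) r :
  kron_diff A B ^+ r =
    \sum_(i < r.+1) ((-1) ^+ i * 'C(r, i)%:R) *: (A ^+ (r - i) *t B ^+ i).
Proof.
rewrite /kron_diff exprBn_comm; last exact: tens_comm.
apply: eq_bigr => i _; rewrite tens_expl tens_expr -mulrA -!mulmxE.
rewrite tensmx_mul mulmx1 mul1mx mulmxE -signr_odd mulr_sign -[in RHS]signr_odd.
case: (odd i); rewrite ?expr1 ?expr0 ?mulN1r ?mul1r ?scaleNr scaler_nat //.
by rewrite mulNrn.
Qed.

Lemma size_list0l t : size_list 0 t = [::].
Proof. by rewrite /size_list min0n. Qed.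

Lemma size_list0r s : size_list s 0 = [::].
Proof. by rewrite /size_list minn0. Qed.

Lemma size_listSS s t :
  size_list s.+1 t.+1 = rcons (size_list s t) (s + t).+1.
Proof.
rewrite /size_list minnSS -[(minn s t).+1]addn1 iotaD map_cat cats1 /=.
congr rcons; last by rewrite minnE; lia.
by apply: eq_map => l; rewrite minnE; lia.
Qed.

Lemma size_list_gt0 s t : all (fun d => 0 < d)%N (size_list s t).
Proof. by apply/allP => d /mapP[l _ ->]; rewrite minnE; lia. Qed.

(** Induction along the surjection S = d/dx + d/dy from
    F[x,y]/(x^(s+1), y^(t+1)) to F[x,y]/(x^s, y^t), which commutes with
    multiplication by x - y and kills the chain of 1.  This chain has length
    s + t + 1 because (x - y)^(s+t) is a nonzero multiple of x^s y^t, and its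
    length is the difference of the two dimensions. *)
Lemma clebsch_gordan (charF0 : [pchar F] =i pred0) s t :
  jordan_dec (kron_diff (nilp_mx s) (nilp_mx t))
    [seq (0, d) | d <- size_list s t].
Proof.
elim: s t => [|s IHs] [|t]; rewrite ?size_list0l ?size_list0r;
  try by apply: jordan_dec_dim0; rewrite ?muln0.
have dB := IHs t; set B := kron_diff _ _ in dB.
set A := kron_diff _ _.
pose S := deriv_mx s *t trunc_mx t + trunc_mx s *t deriv_mx t.
have AS : A *m S = S *m B.
  rewrite /A /S /B /kron_diff !(mulmxDl, mulmxDr, mulmxN, mulNmx) !tensmx_mul.
  rewrite !mulmx1 !mul1mx !nilp_deriv_mx !nilp_trunc_mx !tensDl !tensDr.
  rewrite !opprD !addrA.
  have shuffle (a c d e f : 'M[F]_(s.+1 * t.+1, s * t)) :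
    a + c + d - e - f - c = a - e + d - f.
    by rewrite (addrAC a c) (addrAC _ c) (addrAC _ c) addrK (addrAC a).
  exact: shuffle.
(* R0 is an approximate right inverse: R0 *m S is 1 plus a matrix that raises
   the degree in x, hence a unit. *)
pose R0 := prim_mx s *t (trunc_mx t)^T.
have R0S : R0 *m S \in unitmx.
  have -> : R0 *m S = 1%:M + (prim_mx s *m trunc_mx s)
      *t ((trunc_mx t)^T *m deriv_mx t).
    by rewrite mulmxDr !tensmx_mul (prim_mx_deriv_mx charF0)
      tr_trunc_mx_trunc_mx tens_scalar1.
  apply: (@const_uptri_unit _ _ (1 + 0)); last by rewrite addr0 oner_neq0.
  apply: const_uptriD; first exact: const_uptri_scalar.
  by apply: const_uptri0_tensl; apply: const_uptri_prim_mx_trunc_mx.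
pose R := invmx (R0 *m S) *m R0.
have RS : R *m S = 1%:M by rewrite /R -mulmxA mulVmx.
pose v : 'rV[F]_(s.+1 * t.+1) := delta_mx 0 (mxtens_index (ord0, ord0)).
apply: (@jordan_dec_perm _ _ _ _
  [seq (0, d) | d <- (s + t).+1 :: size_list s t]).
  by apply: perm_map; rewrite size_listSS perm_rcons.
apply: (@jordan_dec_split _ _ _ _ _ _ _ v _ _ _ _ _ _ RS AS dB).
- by rewrite mulSn mulnS; lia.
- rewrite kron_diff_exp big1 // => i _; case: (leqP t.+1 i) => [ti|it].
    by rewrite (nilp_mx_exp0 ti) tensmx0 scaler0.
  by rewrite nilp_mx_exp0 ?tens0mx ?scaler0 //; move: it; clear; lia.
- rewrite -rowE; apply/rV0Pn; exists (mxtens_index (ord_max, ord_max)).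
  (* The coefficient of x^s y^t in (x - y)^(s+t) is, up to sign, a binomial
     coefficient; all other terms vanish. *)
  have lt_t : (t < (s + t).+1)%N by rewrite ltnS leq_addl.
  rewrite mxE kron_diff_exp (bigD1 (Ordinal lt_t)) //= big1 ?addr0 => [|i it].
    rewrite mxE tensmxE !nilp_mx_expE /= addnK !add0n !eqxx !mulr1.
    rewrite mulf_neq0 ?signr_eq0 //.
    by rewrite (natf_neq0 charF0) // bin_gt0 leq_addl.
  have [ti|lti] := leqP t.+1 i.
    by rewrite (nilp_mx_exp0 ti) tensmx0 scaler0.
  rewrite nilp_mx_exp0 ?tens0mx ?scaler0 //.
  by rewrite -val_eqE /= in it; move: it lti; clear; lia.
rewrite -rowE; apply/rowP => k; case: (mxtens_indexP k) => k1 k2.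
by rewrite mxE mxE !tensmxE !mxE !mulr0n mul0r mulr0 addr0.
Qed.

Lemma flatten_enum_sigma (I J : finType) (T : Type) (g : I -> J -> seq T) :
  flatten [seq g (tag x) (tagged x) | x <- enum {: {_ : I & J}}]
  = flatten [seq g i j | i <- enum I, j <- enum J].
Proof.
congr flatten; rewrite !enumT [in LHS]unlock /= /tag_enum map_flatten
  -!map_comp.
congr (flatten _); apply: eq_map => i /=.
by rewrite -map_comp -enumT.
Qed.

Lemma jordan_dec_kron_diff (charF0 : [pchar F] =i pred0) m n
    (A : 'M[F]_m) (B : 'M[F]_n) (s t : seq nat) :
  jordan_dec A [seq (0, d) | d <- s] -> jordan_dec B [seq (0, d) | d <- t] ->
  jordan_dec (kron_diff A B)
    [seq (0, d) | d <- flatten [seq size_list a b | a <- s, b <- t]].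
Proof.
move=> dA dB; have dAB := dsum_tens kron_diff_natural dA dB.
set s' := [seq _ | _ <- s] in dA dAB; set t' := [seq _ | _ <- t] in dB dAB.
pose g (a b : F * nat) := [seq ((0 : F), d) | d <- size_list a.2 b.2].
have /(_ (fun x => g (blk (tag x)) (blk (tagged x)))) := jordan_dec_flatten dAB.
rewrite (flatten_enum_sigma (fun i j => g (blk i) (blk j))).
suff -> : flatten [seq g (blk i) (blk j) | i <- enum 'I_(size s'),
      j <- enum 'I_(size t')] =
    [seq (0, d) | d <- flatten [seq size_list a b | a <- s, b <- t]].
  apply=> x; rewrite !blk_nilp !jordan_block0; exact: (clebsch_gordan charF0).
transitivity (flatten [seq g a b | a <- s', b <- t']).
  rewrite -[in RHS](map_blk_enum s') -[in RHS](map_blk_enum t').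
  by rewrite allpairs_mapl allpairs_mapr.
by rewrite map_flatten map_allpairs /s' /t' allpairs_mapl allpairs_mapr.
Qed.

End ClebschGordan.

(** * Polynomials in a Jordan block *)

Section PowersAndUnits.
Variable F : fieldType.

(** (U A)^r = U^r A^r and U^r is a unit.  As the ranks of the powers determine
    the Jordan form of a nilpotent matrix, commuting units can be dropped when
    looking for it. *)
Lemma rank_mul_unit m (A U V : 'M[F]_m) r :
  U \in unitmx -> GRing.comm U A -> U *m A = V ->
  \rank (V ^+ r) = \rank (A ^+ r).
Proof.
move=> Uu cUA <-; rewrite mulmxE exprMn_comm // -mulmxE.
rewrite eqmxMfull // row_full_unit.
by elim: r => [|r IHr]; rewrite ?unitmx1 // exprS -mulmxE unitmx_mul Uu.
Qed.

(** The s_i are the block sizes of N_m ^+ k: the right-hand side is the rank of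
    its r-th power. *)
Lemma sum_part_size k m r : (0 < k)%N ->
  (\sum_(d <- [seq part_size k m i | i <- iota 1 (minn k m)]) (d - r)
    = m - k * r)%N.
Proof.
have sum_step a q x : (q <= x)%N ->
    (\sum_(i <- iota 1 x) ((if i <= q then a.+1 else a) - r)
      = q * (a.+1 - r) + (x - q) * (a - r))%N.
  move=> qx; rewrite -{1}(subnKC qx) iotaD big_cat /=; congr addn.
    rewrite big_seq (eq_bigr (fun=> a.+1 - r)%N).
      by rewrite -big_seq big_const_seq count_predT size_iota iter_addn_0 mulnC.
    by move=> i; rewrite mem_iota => /andP[_]; rewrite add1n ltnS => ->.
  rewrite big_seq (eq_bigr (fun=> a - r)%N).
    by rewrite -big_seq big_const_seq count_predT size_iota iter_addn_0 mulnC.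
  by move=> i; rewrite mem_iota => /andP[qi _]; rewrite leqNgt qi.
move=> k_gt0; rewrite big_map /part_size /split_div sum_step; last first.
  by case: (leqP m k) => mk /=; rewrite // ltnW // ltn_pmod.
case: (leqP m k) => mk /=.
  rewrite subnn mul0n addn0.
  by case: r {sum_step} => [|r]; move: mk; clear; nia.
have := ltn_pmod m k_gt0; have := divn_eq m k.
move: (m %/ k)%N (m %% k)%N => a q -> qk.
case: (leqP r a) => ra.
  rewrite (subSn ra); move: ra qk => /subnKC <- /ltnW/subnKC <-.
  move: (a - r)%N (k - q)%N => b c; rewrite !addKn.
  have -> : ((r + b) * (q + c) + q = (q + c) * r + (q * b.+1 + c * b))%N.
    by nia.
  by rewrite addKn.
have -> : (a.+1 - r = 0)%N by lia.
have -> : (a - r = 0)%N by lia.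
by rewrite !muln0; move: ra qk; clear; nia.
Qed.

Lemma part_size_gt0 k m :
  all (fun d => 0 < d)%N [seq part_size k m i | i <- iota 1 (minn k m)].
Proof.
apply/allP => d /mapP[i]; rewrite mem_iota => /andP[i_gt0 im] ->.
rewrite /part_size /split_div; case: (leqP m k) => mk /=.
  by rewrite (_ : i <= m)%N //; move: im; rewrite (minn_idPr mk) add1n.
case: ifP => //= _; rewrite divn_gt0 ?(ltnW mk) //.
by move: i_gt0 im; clear; lia.
Qed.

Lemma poly_taylor (p : {poly F}) x n : (size p <= n)%N ->
  p = \sum_(i < n) (p^`N(i).[x])%:P * ('X - x%:P) ^+ i.
Proof.
move=> pn; have cxh : GRing.comm x%:P ('X - x%:P) by apply: mulrC.
have := @nderiv_taylor_wide _ n p^:P _ _ cxh; rewrite size_map_polyC pn.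
rewrite addrC subrK -/(comp_poly 'X p) comp_polyXr => {1}-> //.
by apply: eq_bigr => i _; rewrite nderivn_map horner_map.
Qed.

(** Taylor expansion at x, with the vanishing coefficients removed: the order k is
    the multiplicity of x as a root of p - p.[x]. *)
Lemma hasse_orderP (p : {poly F}) x k : hasse_order p x k ->
  exists2 u : {poly F}, u.[x] != 0 & p = (p.[x])%:P + ('X - x%:P) ^+ k * u.
Proof.
case=> k_gt0 p0 pk; set h := 'X - x%:P.
pose c i := p^`N(i).[x].
exists (\sum_(j < (size p).+1) (c (k + j)%N)%:P * h ^+ j).
  rewrite horner_sum big_ord_recl big1 ?addr0 => [|j _].
    by rewrite expr0 mulr1 hornerC addn0.
  by rewrite exprS mulrCA hornerM hornerXsubC subrr mul0r.
rewrite {1}(@poly_taylor p x (k + (size p).+1));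
  last by rewrite addnS ltnW // ltnS leq_addl.
rewrite big_split_ord /=; congr (_ + _).
  case: k k_gt0 p0 {pk} => // k _ p0.
  rewrite big_ord_recl /= nderivn0 expr0 mulr1 big1 ?addr0 // => i _.
  by rewrite p0 ?mul0r //= /bump leq0n add1n ltnS ltn_ord.
rewrite mulr_sumr; apply: eq_bigr => j _.
by rewrite mulrCA -exprD.
Qed.

Lemma hasse_order_exists (p : {poly F}) x :
  (forall c : F, p != c%:P) -> exists k, hasse_order p x k.
Proof.
move=> p_nc; pose P k := (p^`N(k.+1)).[x] != 0.
have exP : exists k, P k.
  have [/existsP[i Pi]|/existsPn P0] := boolP [exists i : 'I_(size p), P i].
    by exists i.
  case/eqP: (p_nc p.[x]).
  rewrite {1}(@poly_taylor p x (size p).+1) // big_ord_recl nderivn0.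
  rewrite expr0 mulr1 big1 ?addr0 // => i _.
  by have := P0 i; rewrite negbK => /eqP ->; rewrite mul0r.
case: (ex_minnP exP) => k Pk mink; exists k.+1; split=> // -[|i] //= ik.
by apply/eqP; apply: contraLR ik => /mink; rewrite ltnS -leqNgt.
Qed.

Lemma hasse_order_uniq (p : {poly F}) x k l :
  hasse_order p x k -> hasse_order p x l -> k = l.
Proof.
move=> [k0 pk pk1] [l0 pl pl1]; case: (ltngtP k l) => // kl.
  by rewrite pl ?eqxx ?k0 ?kl in pk1.
by rewrite pk ?eqxx ?l0 ?kl in pl1.
Qed.

Lemma const_uptri_horner m (p : {poly F}) c (A : 'M[F]_m.+1) :
  const_uptri c A -> const_uptri p.[c] (horner_mx A p).
Proof.
move=> tA; elim/poly_ind: p => [|p a IHp].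
  by rewrite horner0 raddf0 => i j _; rewrite mxE mul0rn.
rewrite hornerMXaddC rmorphD rmorphM /= horner_mx_X horner_mx_C.
by apply: const_uptriD; [apply: const_uptriM|apply: const_uptri_scalar].
Qed.

(** By Taylor expansion the matrix is u(J) N^k, where u(J) is invertible because
    its diagonal entries are u(c) != 0. *)
Lemma jordan_dec_poly_jordan m c (p : {poly F}) k : hasse_order p c k ->
  jordan_dec (horner_mx (jordan_block m.+1 c) p - (p.[c])%:M)
    [seq (0, d) | d <- [seq part_size k m.+1 i | i <- iota 1 (minn k m.+1)]].
Proof.
move=> pck; have [k_gt0 _ _] := pck; have [u uc Dp] := hasse_orderP pck.
set J := jordan_block _ _; apply: jordan_dec_by_rank => [|r].
  exact: part_size_gt0.
have Nh : nilp_mx m.+1 = horner_mx J ('X - c%:P).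
  by rewrite rmorphB /= horner_mx_X horner_mx_C /J /jordan_block addrC addKr.
have Du : horner_mx J u *m nilp_mx m.+1 ^+ k = horner_mx J p - (p.[c])%:M.
  rewrite {1}Dp Nh -rmorphXn mulmxE -rmorphM mulrC rmorphD /= horner_mx_C.
  by rewrite [RHS]addrC addKr.
rewrite (rank_mul_unit r _ _ Du).
- by rewrite sum_part_size // -exprM rank_nilp_mx.
- exact: (const_uptri_unit (const_uptri_horner u (@const_uptri_jordan _ _ c))).
by rewrite Nh -rmorphXn; apply: comm_horner_mx2.
Qed.

End PowersAndUnits.

(** * The function of two Jordan blocks *)

Section PairOfBlocks.
Variable F : fieldType.

Lemma const_uptri_Pmx L (f : {poly F}) m n l mu (A : 'M[F]_m) (B : 'M[F]_n) :
  const_uptri l A -> const_uptri mu B -> exists c, const_uptri c (Pmx L f A B).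
Proof.
move=> tA tB; eexists; apply: const_uptri_sum => i; apply: const_uptriZ.
by apply: const_uptri_sum => j; apply: const_uptri_tens; apply: const_uptriX;
  eassumption.
Qed.

(** The function is computed from upper triangular matrices with constant
    diagonals, so it is a scalar plus a nilpotent matrix, even for equal
    eigenvalues. *)
Lemma Pblock_jordan_form L (f : {poly F}) (b c : F * nat) :
  exists s, jordan_form (Pblock L f b c) s.
Proof.
have [nu tP] := const_uptri_Pmx L f (@const_uptri_jordan _ b.2 b.1)
  (@const_uptri_jordan _ c.2 c.1).
rewrite -/(Pblock L f b c) in tP.
have t0 : const_uptri 0 (- nu%:M + Pblock L f b c).
  rewrite -(addNr nu); apply: const_uptriD => // i j _.
  by rewrite !mxE mulNrn.
have [s [s_gt0 ds]] := nilp_jordan_dec (const_uptri_nilp t0).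
exists [seq (nu, d) | d <- s]; apply/jordan_formP; split;
  first by rewrite all_map.
by have := jordan_dec_scalar nu ds; rewrite addrA subrr add0r.
Qed.

Lemma Pmx_natural L (f : {poly F}) m m' n n' (A : 'M_m) (A' : 'M_m')
    (B : 'M_n) (B' : 'M_n') (P : 'M_(m, m')) (Q : 'M_(n, n')) :
  A *m P = P *m A' -> B *m Q = Q *m B' ->
  Pmx L f A B *m (P *t Q) = (P *t Q) *m Pmx L f A' B'.
Proof.
move=> AP BQ; rewrite mulmx_suml mulmx_sumr; apply: eq_bigr => i _.
rewrite -scalemxAl -scalemxAr mulmx_suml mulmx_sumr; congr (_ *: _).
by apply: eq_bigr => j _; rewrite !tensmx_mul; congr (_ *t _);
  apply: exp_intertwining.
Qed.

(** The identity (x - y) p(x, y) = f(x) - f(y) at commuting matrices. *)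
Lemma kron_diff_Pmx L (f : {poly F}) m n (A : 'M[F]_m.+1) (B : 'M[F]_n.+1) :
  (size f <= L.+2)%N ->
  kron_diff A B *m Pmx L f A B = kron_diff (horner_mx A f) (horner_mx B f).
Proof.
move=> szf.
have hornerE k (C : 'M[F]_k.+1) :
    horner_mx C f = \sum_(i < L.+2) f`_i *: C ^+ i.
  rewrite {1}(_ : f = \sum_(i < L.+2) f`_i *: 'X^i).
    rewrite rmorph_sum; apply: eq_bigr => i _ /=.
    by rewrite linearZ /= rmorphXn /= horner_mx_X.
  rewrite -poly_def; apply/polyP => i; rewrite coef_poly.
  by case: ltnP => // Li; rewrite nth_default ?(leq_trans szf).
rewrite !hornerE /kron_diff /Pmx tens_suml tens_sumr -sumrB.
rewrite [RHS]big_ord_recl [X in _ = X + _](_ : _ = 0) ?add0r; last first.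
  by rewrite tensZl tensZr !expr0 subrr.
rewrite mulmx_sumr; apply: eq_bigr => i _; rewrite -scalemxAr lift0.
have -> : (A *t 1%:M - 1%:M *t B) *m \sum_(j < i.+1) (A ^+ j *t B ^+ (i - j))
    = A ^+ i.+1 *t 1%:M - 1%:M *t B ^+ i.+1.
  rewrite -tens_expl -tens_expr subrXX_comm; last exact: tens_comm.
  rewrite mulmxE; congr (_ * _).
  rewrite (reindex_inj rev_ord_inj) /=; apply: eq_bigr => j _.
  rewrite tens_expl tens_expr -mulmxE tensmx_mul mulmx1 mul1mx subSS.
  by rewrite subKn // -ltnS.
by rewrite scalerBr tensZl tensZr.
Qed.

(** The same identity for phi in place of f: subtracting nu w from f(w)
    subtracts the constant nu from the divided difference. *)
Lemma Pblock_slope L (f : {poly F}) l mu m n : (size f <= L.+2)%N -> l != mu ->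
  kron_diff (jordan_block m.+1 l) (jordan_block n.+1 mu)
      *m (Pblock L f (l, m.+1) (mu, n.+1) - (slope f l mu)%:M)
    = kron_diff
        (horner_mx (jordan_block m.+1 l) (phi f l mu) - (phi f l mu).[l]%:M)
        (horner_mx (jordan_block n.+1 mu) (phi f l mu) - (phi f l mu).[mu]%:M).
Proof.
move=> szf lmu.
have phi_eq : (phi f l mu).[l] = (phi f l mu).[mu].
  by rewrite /phi !hornerE /slope; field; rewrite subr_eq0.
rewrite mulmxBr kron_diff_Pmx // mul_mx_scalar phi_eq /kron_diff.
set J := jordan_block _ _; set K := jordan_block _ _.
have DJ (k : nat) (C : 'M_k.+1) :
    horner_mx C (phi f l mu) = horner_mx C f - slope f l mu *: C.
  by rewrite /phi rmorphB /= linearZ /= horner_mx_X.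
rewrite !DJ !tensBl !tensBr !tensZl !tensZr -!(scalemx1 _ (phi _ _ _).[_]).
rewrite tensZl tensZr scalerBr opprB [in RHS]opprB [RHS]addrA subrK.
rewrite [in RHS]opprB.
by rewrite addrACA [RHS]addrACA; congr (_ + _); apply: addrC.
Qed.

Lemma jordan_dec_Pblock L (f : {poly F}) l mu m n k h :
  [pchar F] =i pred0 -> (size f <= L.+2)%N -> l != mu ->
  (0 < m)%N -> (0 < n)%N ->
  hasse_order (phi f l mu) l k -> hasse_order (phi f l mu) mu h ->
  jordan_form (Pblock L f (l, m) (mu, n))
    (pair_blocks (slope f l mu) k m h n).
Proof.
case: m n => [|m] [|n] // char0 szf lmu _ _ lk muh.
have := Pblock_slope m n szf lmu.
set E := kron_diff _ _; set D := (Pblock _ _ _ _ - _); move=> ED.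
have := jordan_dec_kron_diff char0 (jordan_dec_poly_jordan m lk)
  (jordan_dec_poly_jordan n muh).
set sizes := flatten _ => dE.
have sizes_gt0 : all (fun d => 0 < d)%N sizes.
  apply/allP => d /flattenP[_ /allpairsP[[a b] [_ _ ->]]].
  exact: (allP (size_list_gt0 a b)).
have Eu : E \in unitmx.
  apply: (@const_uptri_unit _ _ (l - mu)); last by rewrite subr_eq0.
  have -> : l - mu = l * 1 + (- 1) * (1 * mu) by rewrite mulr1 mulN1r mul1r.
  rewrite /E /kron_diff -[- (_ *t _)]scaleN1r.
  by apply: const_uptriD; [|apply: const_uptriZ]; apply: const_uptri_tens;
    by [apply: const_uptri_jordan|apply: const_uptri_scalar].
have cED : GRing.comm E D.
  apply: commrB; last exact: comm_mx_scalar.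
  rewrite /GRing.comm -mulmxE mulmxBl mulmxBr.
  by congr (_ - _); apply/esym; apply: Pmx_natural; rewrite ?mulmx1 ?mul1mx.
have dD : jordan_dec D [seq (0, d) | d <- sizes].
  apply: jordan_dec_by_rank => // r.
  by rewrite -(rank_mul_unit r Eu cED ED) (rank_jordan_dec r dE).
apply/jordan_formP.
have -> : pair_blocks (slope f l mu) k m.+1 h n.+1 =
    [seq (slope f l mu, d) | d <- sizes].
  by rewrite map_flatten map_allpairs allpairs_mapl allpairs_mapr.
split; first by rewrite all_map.
by have := jordan_dec_scalar (slope f l mu) dD; rewrite addrC subrK.
Qed.

End PairOfBlocks.

(** * Jordan blocks of the bivariate function *)

(* For X and Y with Jordan blocks sX and sY, B i j is the list of the Jordan
   blocks of P(X, Y) associated with the i-th block of X and j-th block of Y. *)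
Theorem theorem4p4 (F : closedFieldType) (charF0 : [pchar F] =i pred0)
    (L : nat) (f : {poly F}) (size_f : (size f <= L.+2)%N)
    (M N : nat) (X : 'M[F]_M) (Y : 'M[F]_N)
    (sX sY : seq (F * nat))
    (jfX : jordan_form X sX) (jfY : jordan_form Y sY) :
  similar_mx (Pmx L f X Y)
    (\mxdiag_(i < size sX) \mxdiag_(j < size sY) Pblock L f (blk i) (blk j))
  /\
  exists B : 'I_(size sX) -> 'I_(size sY) -> seq (F * nat),
    [/\ forall (i : 'I_(size sX)) (j : 'I_(size sY)),
          jordan_form (Pblock L f (blk i) (blk j)) (B i j),
        jordan_form (Pmx L f X Y)
          (flatten [seq B i j | i <- enum 'I_(size sX), j <- enum 'I_(size sY)])
      & forall (i : 'I_(size sX)) (j : 'I_(size sY))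
               (lambda mu : F) (m n k h : nat),
          blk i = (lambda, m) -> blk j = (mu, n) -> lambda != mu ->
          (forall c : F, phi f lambda mu != c%:P) ->
          hasse_order (phi f lambda mu) lambda k ->
          hasse_order (phi f lambda mu) mu h ->
          perm_eq (B i j) (pair_blocks (slope f lambda mu) k m h n)].
Proof.
move: jfX jfY => /jordan_formP[sX_gt0 formX] /jordan_formP[sY_gt0 formY].
have dP := dsum_tens (@Pmx_natural F L f) formX formY.
split.
  apply/similar_mxP; apply: dsum_msim dP _.
  have dnested := dsum_mxdiag (fun i : 'I_(size sX) =>
    \mxdiag_(j < size sY) Pblock L f (blk i) (blk j)).
  exact: (dsum_sigma dnested (fun i => dsum_mxdiag _)).
have blk_gt0 (s : seq (F * nat)) (i : 'I_(size s)) :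
    all (fun b => 0 < b.2)%N s -> (0 < (blk i).2)%N.
  by move=> /allP; apply; apply: mem_blk.
have exB (x : {_ : 'I_(size sX) & 'I_(size sY)}) : exists B : seq (F * nat),
    jordan_form (Pblock L f (blk (tag x)) (blk (tagged x))) B /\
    forall (lambda mu : F) (m n k h : nat),
      blk (tag x) = (lambda, m) -> blk (tagged x) = (mu, n) -> lambda != mu ->
      (forall c : F, phi f lambda mu != c%:P) ->
      hasse_order (phi f lambda mu) lambda k ->
      hasse_order (phi f lambda mu) mu h ->
      perm_eq B (pair_blocks (slope f lambda mu) k m h n).
  case: x => i j /=; have := blk_gt0 _ i sX_gt0; have := blk_gt0 _ j sY_gt0.
  case: (blk i) (blk j) => [l m] [mu n] /= n_gt0 m_gt0.
  have [s js] := Pblock_jordan_form L f (l, m) (mu, n).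
  have [Dmu|lmu] := eqVneq l mu.
    by rewrite -Dmu in js *; exists s; split=> // l' mu' ? ? ? ? [<- _] [<- _];
      rewrite eqxx.
  have [/size1_polyC Dphi|sz_phi] := leqP (size (phi f l mu)) 1.
    exists s; split=> // l' mu' ? ? ? ? [<- _] [<- _] _.
    by move=> /(_ (phi f l mu)`_0); rewrite -Dphi eqxx.
  have phi_nc c : phi f l mu != c%:P.
    by apply: contraTneq sz_phi => ->; rewrite -leqNgt size_polyC leq_b1.
  have [k lk] := hasse_order_exists l phi_nc.
  have [h muh] := hasse_order_exists mu phi_nc.
  exists (pair_blocks (slope f l mu) k m h n); split.
    exact: jordan_dec_Pblock.
  move=> l' mu' m' n' k' h' [<- <-] [<- <-] _ _.
  by move=> /(hasse_order_uniq lk) <- /(hasse_order_uniq muh) <-.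
have [B /all_and2[jB permB]] := fin_all_exists exB.
exists (fun i j => B (existT _ i j)); split=> [i j||i j].
- exact: (jB (existT _ i j)).
- have jBd x := (proj1 (jordan_formP _ _) (jB x)).
  apply/jordan_formP; split.
    apply/allP => b /flattenP[_ /allpairsP[[i j] [_ _ ->]]].
    exact: (allP (jBd (existT _ i j)).1).
  rewrite -(flatten_enum_sigma (fun i j => B (existT _ i j))).
  apply: jordan_dec_flatten dP _ => -[i j]; exact: (jBd (existT _ i j)).2.
exact: (permB (existT _ i j)).
Qed.
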